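(* Let $m\ge 1$ and $1\le p<\infty$. Then $(F_B(\mathbb{R}^m)^p, d_p)$ is the completion of $(F_B(\mathbb{R}^m), d_p)$.
   Context: $H$ is the Hausdorff metric on nonempty closed subsets of $\mathbb{R}^m$ (Euclidean distance): $H(A,B)=\max\{\sup_{a\in A}\inf_{b\in B}d(a,b),\ \sup_{b\in B}\inf_{a\in A}d(a,b)\}$ (possibly $+\infty$). A fuzzy set on $\mathbb{R}^m$ is a function $u:\mathbb{R}^m\to[0,1]$; its cuts are $[u]_\alpha=\{x: u(x)\ge\alpha\}$ for $\alpha\in(0,1]$ and $[u]_0=\overline{\{x: u(x)>0\}}$. $F_B(\mathbb{R}^m)$ is the set of fuzzy sets $u$ on $\mathbb{R}^m$ that are normal ($u(x_0)=1$ for some $x_0$), upper semi-continuous, and have $[u]_0$ bounded. $F_B(\mathbb{R}^m)^p\supset F_B(\mathbb{R}^m)$ is the set of normal upper semi-continuous fuzzy sets $u$ with $\left(\int_0^1 H([u]_\alpha,\{0\})^p\,d\alpha\right)^{1/p}<+\infty$, where $0$ is the origin. The metric on both is $d_p(u,v)=\left(\int_0^1 H([u]_\alpha,[v]_\alpha)^p\,d\alpha\right)^{1/p}$. A metric space $Y$ is the completion of a subspace $X\subset Y$ if $Y$ is complete and $X$ is dense in $Y$. *)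

(* Defs.v *)
From HB Require Import structures.
From mathcomp Require Import all_boot all_order all_algebra.
From mathcomp Require Import all_classical all_reals all_analysis.

Set Implicit Arguments.
Unset Strict Implicit.
Unset Printing Implicit Defensive.

Import Order.TTheory GRing.Theory Num.Theory.
Import numFieldNormedType.Exports.

Local Open Scope classical_set_scope.
Local Open Scope ring_scope.

(* The library norm on row vectors is the sup norm, so the Euclidean distance
   is defined here; both induce the same topology, and [closure] and [nbhs]
   are taken from the library. *)
Definition eucl_dist (R : realType) (m : nat) (x y : 'rV[R]_m) : R :=
  Num.sqrt (\sum_(i < m) (x 0 i - y 0 i) ^+ 2).

Definition hausdorff (R : realType) (m : nat) (A B : set 'rV[R]_m) : \bar R :=
  maxe (ereal_sup [set ereal_inf [set (eucl_dist a b)%:E | b in B] | a in A])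
       (ereal_sup [set ereal_inf [set (eucl_dist a b)%:E | a in A] | b in B]).

Definition eucl_bounded (R : realType) (m : nat) (A : set 'rV[R]_m) : Prop :=
  exists M : R, forall x, A x -> eucl_dist x 0 <= M.

Definition upper_semicontinuous (R : realType) (T : topologicalType)
    (f : T -> R) : Prop :=
  forall (x : T) (a : R), f x < a -> \forall y \near x, f y < a.

Definition is_fuzzy_set (R : realType) (m : nat) (u : 'rV[R]_m -> R) : Prop :=
  forall x, 0 <= u x <= 1.

(* Only meaningful for alpha in [0, 1]. *)
Definition alpha_cut (R : realType) (m : nat) (u : 'rV[R]_m -> R) (alpha : R) :
    set 'rV[R]_m :=
  if alpha == 0 then closure [set x | 0 < u x] else [set x | alpha <= u x].

Definition is_normal (R : realType) (m : nat) (u : 'rV[R]_m -> R) : Prop :=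
  exists x0, u x0 = 1.

Definition lp_dist (R : realType) (m : nat) (p : R)
    (A B : R -> set 'rV[R]_m) : \bar R :=
  ((\int[lebesgue_measure]_(alpha in `[0%R, 1%R])
     (hausdorff (A alpha) (B alpha) `^ p)) `^ p^-1)%E.

Definition d_p (R : realType) (m : nat) (p : R) (u v : 'rV[R]_m -> R) :
    \bar R :=
  lp_dist p (alpha_cut u) (alpha_cut v).

Definition F_B (R : realType) (m : nat) : set ('rV[R]_m -> R) :=
  [set u | [/\ is_fuzzy_set u, is_normal u, upper_semicontinuous u &
               eucl_bounded (alpha_cut u 0)]].

Definition F_Bp (R : realType) (m : nat) (p : R) : set ('rV[R]_m -> R) :=
  [set u | [/\ is_fuzzy_set u, is_normal u, upper_semicontinuous u &
               (lp_dist p (alpha_cut u) (fun=> [set 0%R]) < +oo)%E]].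

(* Metric spaces are given as a subset Y of a type with an extended-real valued
   function d; that d is finite on Y is part of being a metric. *)
Definition metric_on (R : realType) (T : Type) (Y : set T)
    (d : T -> T -> \bar R) : Prop :=
  [/\ forall x y, Y x -> Y y -> d x y \is a fin_num /\ (0 <= d x y)%E,
      forall x y, Y x -> Y y -> (d x y = 0%E <-> x = y),
      forall x y, Y x -> Y y -> d x y = d y x &
      forall x y z, Y x -> Y y -> Y z -> (d x z <= d x y + d y z)%E].

Definition cauchy_seq (R : realType) (T : Type) (d : T -> T -> \bar R)
    (x : nat -> T) : Prop :=
  forall e : R, 0 < e -> exists N : nat, forall i j : nat,
    (N <= i)%N -> (N <= j)%N -> (d (x i) (x j) < e%:E)%E.

Definition complete_on (R : realType) (T : Type) (Y : set T)
    (d : T -> T -> \bar R) : Prop :=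
  forall x : nat -> T, (forall n, Y (x n)) -> cauchy_seq d x ->
    exists2 l, Y l & d (x n) l @[n --> \oo] --> 0%E.

Definition dense_in (R : realType) (T : Type) (X Y : set T)
    (d : T -> T -> \bar R) : Prop :=
  forall y, Y y -> forall e : R, 0 < e -> exists2 x, X x & (d x y < e%:E)%E.

Definition is_completion (R : realType) (T : Type) (X Y : set T)
    (d : T -> T -> \bar R) : Prop :=
  [/\ metric_on Y d, X `<=` Y, complete_on Y d & dense_in X Y d].

(* Main.v *)
(* Let h_uv(a) = H([u]_a, [v]_a) on ]0, 1].  For normal, upper semicontinuous u
   and v with compact positive levels, h_uv is left continuous, hence
   measurable, d_p(u, v) is the L^p norm of h_uv, and Minkowski's inequality
   makes d_p a metric.  Finiteness of d_p(u, 1_{0}) forces the positive levels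
   of u to be bounded.  Density: truncate u below the height 1/n and use
   dominated convergence.

   Completeness: a fast subsequence y_k of a Cauchy sequence satisfies, for
   almost every a, H([y_k]_a, [y_{k+1}]_a) = O(2^-k), so [y_k]_a converges to a
   compact set K_a.  The limit is u(x) = sup {a | x \in K_a}; its level [u]_a is
   the intersection of the K_b for b < a, and it differs from K_a for at most
   countably many a.  Fatou's lemma then bounds d_p(x_n, u). *)

Require Import Defs.
From mathcomp Require Import all_boot all_order all_algebra.
From mathcomp Require Import all_classical all_reals all_analysis.
From mathcomp Require Import measurable_realfun.
From mathcomp Require Import ring lra.

Set Implicit Arguments.
Unset Strict Implicit.
Unset Printing Implicit Defensive.

Import Order.TTheory GRing.Theory Num.Theory.
Import numFieldNormedType.Exports.

Local Open Scope classical_set_scope.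
Local Open Scope ring_scope.

(** * Euclidean distance on row vectors and the topology it induces *)

Section euclidean_distance.
Context {R : realType} {m : nat}.
Implicit Types (x y z : 'rV[R]_m) (a b : 'I_m -> R).

(** Cauchy-Schwarz: with [s] and [t] the norms of [a] and [b], expand the nonnegative sum of the
    squares of [t * a i - s * b i] and divide by [s * t]. If [s * t = 0], one of the vectors
    vanishes. *)
Lemma sum_mul_le_sqrt a b : \sum_i a i * b i <=
  Num.sqrt (\sum_i a i ^+ 2) * Num.sqrt (\sum_i b i ^+ 2).
Proof.
set A := \sum_i a i ^+ 2; set B := \sum_i b i ^+ 2.
have A0 : 0 <= A by apply: sumr_ge0 => i _; exact: sqr_ge0.
have B0 : 0 <= B by apply: sumr_ge0 => i _; exact: sqr_ge0.
have sA := sqr_sqrtr A0; have sB := sqr_sqrtr B0.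
set s := Num.sqrt A in sA *; set t := Num.sqrt B in sB *.
have s0 : 0 <= s by exact: sqrtr_ge0.
have t0 : 0 <= t by exact: sqrtr_ge0.
have zero (c d : 'I_m -> R) : \sum_i c i ^+ 2 = 0 -> \sum_i c i * d i = 0.
  move=> /eqP; rewrite psumr_eq0 => [/allP c0|i _]; last exact: sqr_ge0.
  rewrite big1// => i _; have := c0 i; rewrite mem_index_enum => /(_ isT) /=.
  by rewrite sqrf_eq0 => /eqP ->; rewrite mul0r.
have [st0|] := eqVneq (s * t) 0.
  rewrite st0; move/eqP: st0; rewrite mulf_eq0 => /orP[] /eqP E.
    by rewrite zero// -/A -sA E expr0n.
  under eq_bigr do rewrite mulrC.
  by rewrite zero// -/B -sB E expr0n.
move=> stN0; have st : 0 < s * t by rewrite lt_neqAle eq_sym stN0 mulr_ge0.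
have : 0 <= \sum_i (t * a i - s * b i) ^+ 2.
  by apply: sumr_ge0 => i _; exact: sqr_ge0.
have -> : \sum_i (t * a i - s * b i) ^+ 2 =
    t ^+ 2 * A + s ^+ 2 * B - (s * t) * (2 * \sum_i a i * b i).
  rewrite !mulr_sumr -big_split/= -sumrB; apply: eq_bigr => i _; ring.
rewrite sA sB -sA -sB => h.
have : 0 <= (s * t) * (2 * (s * t - \sum_i a i * b i)) by move: h; nra.
by rewrite pmulr_rge0// pmulr_rge0// subr_ge0.
Qed.

Lemma eucl_dist_ge0 x y : 0 <= eucl_dist x y.
Proof. exact: sqrtr_ge0. Qed.

Lemma eucl_distC x y : eucl_dist x y = eucl_dist y x.
Proof. by congr Num.sqrt; apply: eq_bigr => i _; rewrite -sqrrN opprB. Qed.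

Lemma eucl_distxx x : eucl_dist x x = 0.
Proof.
by rewrite /eucl_dist big1 ?sqrtr0// => i _; rewrite subrr expr0n.
Qed.

Lemma eucl_dist_triangle y x z :
  eucl_dist x z <= eucl_dist x y + eucl_dist y z.
Proof.
rewrite -(@ler_pXn2r _ 2)// ?nnegrE ?addr_ge0 ?eucl_dist_ge0//.
have sum_sqr_ge0 (a : 'I_m -> R) : 0 <= \sum_i a i ^+ 2.
  by apply: sumr_ge0 => i _; exact: sqr_ge0.
rewrite sqrrD /eucl_dist !sqr_sqrtr//.
have := sum_mul_le_sqrt (fun i => x 0 i - y 0 i) (fun i => y 0 i - z 0 i).
have -> : \sum_i (x 0 i - z 0 i) ^+ 2 = \sum_i (x 0 i - y 0 i) ^+ 2 +
   (\sum_i (x 0 i - y 0 i) * (y 0 i - z 0 i)) *+ 2 +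
   \sum_i (y 0 i - z 0 i) ^+ 2.
  by rewrite -sumrMnl -!big_split/=; apply: eq_bigr => i _; ring.
by move=> h; rewrite lerD2r lerD2l lerMn2r h.
Qed.

Lemma norm_le_eucl_dist x y : `|x - y| <= eucl_dist x y.
Proof.
rewrite [leLHS]/Num.norm/= mx_normrE; apply/bigmax_leP => /=; split => [|[i j] _].
  exact: eucl_dist_ge0.
rewrite -sqrtr_sqr !mxE/= ler_sqrt; last by apply: sumr_ge0 => k _; exact: sqr_ge0.
by rewrite (bigD1 j)//= (ord1 i) lerDl; apply: sumr_ge0 => k _; exact: sqr_ge0.
Qed.

(** Each of the [m] squares is at most the squared sup norm; [m <= m ^ 2] then trades the sharp
    constant, the root of [m], for [m]. *)
Lemma eucl_dist_le_norm x y : eucl_dist x y <= m%:R * `|x - y|.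
Proof.
rewrite -[leRHS]ger0_norm ?mulr_ge0// -sqrtr_sqr ler_sqrt ?sqr_ge0//.
have le_i i : (x 0 i - y 0 i) ^+ 2 <= `|x - y| ^+ 2.
  rewrite -real_normK ?num_real// ler_pXn2r ?nnegrE//.
  rewrite [leRHS]/Num.norm/= mx_normrE.
  apply: le_trans (le_bigmax_cond _ _ (_ : xpredT (0, i)))=> //=.
  by rewrite !mxE.
apply: (@le_trans _ _ (\sum_(i < m) `|x - y| ^+ 2)); first exact: ler_sum.
rewrite sumr_const card_ord -[leLHS]mulr_natl exprMn ler_wpM2r ?sqr_ge0//.
by rewrite -natrX ler_nat -mulnn; case: (m) => // n; rewrite leq_pmulr.
Qed.

Lemma nbhs_eucl_distP x (U : set 'rV[R]_m) :
  nbhs x U <-> exists2 e : R, 0 < e & forall y, eucl_dist x y < e -> U y.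
Proof.
split=> [/nbhs_ballP[e /= e0 eU]|[e e0 eU]].
  exists e => // y xy; apply: eU; rewrite -ball_normE/=.
  exact: le_lt_trans (norm_le_eucl_dist _ _) xy.
apply/nbhs_ballP; exists (e / m.+1%:R) => /=; first by rewrite divr_gt0.
move=> y; rewrite -ball_normE/= ltr_pdivlMr// => xy; apply: eU.
apply: le_lt_trans (eucl_dist_le_norm _ _) _.
by apply: le_lt_trans xy; rewrite mulrC ler_wpM2l// ler_nat.
Qed.

Lemma compact_eucl (A : set 'rV[R]_m) :
  eucl_bounded A -> closed A -> compact A.
Proof.
move=> [M AM]; apply: bounded_closed_compact; exists M.
split; first exact: num_real.
move=> N MN x /AM xM /=; have := norm_le_eucl_dist x 0; rewrite subr0 => h.
exact: le_trans h (le_trans xM (ltW MN)).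
Qed.

Lemma eucl_cauchy_cvg (x : nat -> 'rV[R]_m) :
  (forall e, 0 < e -> exists N, forall i j, (N <= i)%N -> (N <= j)%N ->
     eucl_dist (x i) (x j) < e) ->
  exists l, forall e, 0 < e -> exists N, forall i, (N <= i)%N ->
     eucl_dist l (x i) < e.
Proof.
move=> cx; have cvgx : cvgn x.
  apply: cauchy_cvg; apply/cauchyP => e e0.
  have [N hN] := cx _ e0; exists (x N).
  exists N => // j /= Nj; rewrite -ball_normE /=.
  exact: le_lt_trans (norm_le_eucl_dist _ _) (hN _ _ _ _).
exists (limn x) => e e0.
have [|N _ hN] := cvgx [set y | eucl_dist (limn x) y < e].
  by apply/nbhs_eucl_distP; exists e.
by exists N => i Ni; exact: hN.
Qed.

(** Sequential form of compactness: the cluster point is approached at arbitrarily late indices,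
    which replaces the extraction of a subsequence. *)
Lemma compact_seq_cluster (K : set 'rV[R]_m) (x : nat -> 'rV[R]_m) :
  compact K -> (forall n, K (x n)) ->
  exists2 l, K l & forall e, 0 < e -> forall N,
    exists2 k, (N <= k)%N & eucl_dist l (x k) < e.
Proof.
move=> cK xK; have [l [Kl cl]] : K `&` cluster (x @ \oo) !=set0.
  by apply: cK; exists 0%N => // n _ /=; exact: xK.
exists l => // e e0 N.
have [||z [[k /= Nk <-] lz]] :=
    cl (x @` [set k | (N <= k)%N]) [set y | eucl_dist l y < e].
- by exists N => // k /= Nk; exists k.
- by apply/nbhs_eucl_distP; exists e.
by exists k.
Qed.

Lemma closed_eucl (A : set 'rV[R]_m) x : closed A ->
  (forall e, 0 < e -> exists2 y, A y & eucl_dist x y < e) -> A x.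
Proof.
move=> cA xA; apply: cA => U /nbhs_eucl_distP[e /xA[y Ay xy] eU].
by exists y; split => //; exact: eU.
Qed.

End euclidean_distance.

(** * The Hausdorff distance through its two one-sided excesses *)

Section hausdorff_distance.
Context {R : realType} {m : nat}.
Implicit Types (A B C : set 'rV[R]_m) (r s : R).

(** One-sided Hausdorff bound: every point of [A] is at distance at most [r] from [B]. The slack [e]
    is there because the infimum over [B] need not be attained. *)
Definition excess_le A B r :=
  forall e, 0 < e -> forall a, A a -> exists2 b, B b & eucl_dist a b < r + e.

Lemma ereal_inf_eucl_dist_leP (a : 'rV[R]_m) B r :
  (ereal_inf [set (eucl_dist a b)%:E | b in B] <= r%:E)%E <->
  forall e, 0 < e -> exists2 b, B b & eucl_dist a b < r + e.
Proof.
split=> [h e e0|h].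
  have /ereal_inf_ltP[_ [b Bb <-]] :
      (ereal_inf [set (eucl_dist a b)%:E | b in B] < (r + e)%:E)%E.
    by apply: le_lt_trans h _; rewrite lte_fin ltrDl.
  by rewrite lte_fin => ?; exists b.
apply/lee_addgt0Pr => e /h[b Bb ab].
apply: (@le_trans _ _ (eucl_dist a b)%:E).
  by apply: ereal_inf_lbound; exists b.
by rewrite -EFinD lee_fin ltW.
Qed.

Lemma hausdorff_leP A B r :
  (hausdorff A B <= r%:E)%E <-> excess_le A B r /\ excess_le B A r.
Proof.
rewrite /hausdorff ge_max; split=> [/andP[AB BA]|[AB BA]].
  split=> e e0 a Aa.
    apply: (ereal_inf_eucl_dist_leP a B r).1 => //; apply: le_trans AB.
    by apply: ereal_sup_ubound; exists a.
  have [|b Ab ab] := (ereal_inf_eucl_dist_leP a A r).1 _ e e0.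
    apply: le_trans BA; apply: ereal_sup_ubound; exists a => //.
    by congr ereal_inf; apply: eq_imagel => x _; rewrite eucl_distC.
  by exists b.
apply/andP; split; apply: ge_ereal_sup => _ [a Aa <-].
  by apply/ereal_inf_eucl_dist_leP => e e0; exact: AB.
under eq_imagel do rewrite eucl_distC.
by apply/ereal_inf_eucl_dist_leP => e e0; exact: BA.
Qed.

Lemma hausdorffC A B : hausdorff A B = hausdorff B A.
Proof.
rewrite /hausdorff maxC; congr maxe; congr ereal_sup; apply: eq_imagel => x _;
  by congr ereal_inf; apply: eq_imagel => y _; rewrite eucl_distC.
Qed.

Lemma hausdorff_ge0 A B : A !=set0 -> (0 <= hausdorff A B)%E.
Proof.
move=> [a Aa]; rewrite /hausdorff le_max; apply/orP; left.
apply: le_trans (ereal_sup_ubound _); last by exists a.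
by apply: le_ereal_inf_tmp => _ [b _ <-]; rewrite lee_fin eucl_dist_ge0.
Qed.

Lemma excess_le_trans B A C r s :
  excess_le A B r -> excess_le B C s -> excess_le A C (r + s).
Proof.
move=> AB BC e e0 a Aa; have e20 : 0 < e / 2 by rewrite divr_gt0.
have [b Bb ab] := AB _ e20 a Aa; have [c Cc bc] := BC _ e20 b Bb.
by exists c => //; apply: le_lt_trans (eucl_dist_triangle b _ _) _; lra.
Qed.

Lemma excess_le_subset A B r : 0 <= r -> A `<=` B -> excess_le A B r.
Proof.
by move=> r0 AB e e0 a /AB Ba; exists a => //; rewrite eucl_distxx; lra.
Qed.

Lemma excess_le_bounded A B : B !=set0 -> eucl_bounded A ->
  exists r, excess_le A B r.
Proof.
move=> [b Bb] [M AM]; exists (M + eucl_dist 0 b) => e e0 a /AM aM; exists b => //.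
by apply: le_lt_trans (eucl_dist_triangle 0 _ _) _; lra.
Qed.

Lemma excess_le_widen A B r s : r <= s -> excess_le A B r -> excess_le A B s.
Proof.
move=> rs AB e e0 a Aa; have [b Bb ab] := AB _ e0 _ Aa.
by exists b => //; lra.
Qed.

Lemma hausdorff_fin_num A B : A !=set0 -> B !=set0 -> eucl_bounded A ->
  eucl_bounded B -> hausdorff A B \is a fin_num.
Proof.
move=> A0 B0 bA bB; rewrite ge0_fin_numE ?hausdorff_ge0//.
have [r Ar] := excess_le_bounded B0 bA; have [s Bs] := excess_le_bounded A0 bB.
apply: le_lt_trans (ltry (Num.max r s)); apply/hausdorff_leP.
by split; [apply: excess_le_widen Ar|apply: excess_le_widen Bs];
  rewrite le_max lexx ?orbT.
Qed.

Lemma hausdorff_eq0 A B : closed A -> closed B ->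
  (hausdorff A B <= 0)%E -> A = B.
Proof.
move=> cA cB /hausdorff_leP[AB BA]; rewrite predeqE => x; split=> [Ax|Bx].
  by apply: closed_eucl => // e e0; have := AB e e0 x Ax; rewrite add0r.
by apply: closed_eucl => // e e0; have := BA e e0 x Bx; rewrite add0r.
Qed.

(** [fine] sends infinite values to 0, so this real number represents the distance faithfully when
    the latter is finite, as for nonempty bounded sets. *)
Definition hdist A B : R := fine (hausdorff A B).

Lemma hdistC A B : hdist A B = hdist B A.
Proof. by rewrite /hdist hausdorffC. Qed.

Definition nonempty_bounded A := A !=set0 /\ eucl_bounded A.

Lemma hdistE A B : nonempty_bounded A -> nonempty_bounded B ->
  hausdorff A B = (hdist A B)%:E.
Proof. by move=> [? ?] [? ?]; rewrite fineK// hausdorff_fin_num. Qed.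

Lemma hdist_ge0 A B : 0 <= hdist A B.
Proof.
rewrite /hdist; have [[a Aa]|/set0P/negP/negPn/eqP ->] := pselect (A !=set0).
  by apply: fine_ge0; apply: hausdorff_ge0; exists a.
have [[b Bb]|/set0P/negP/negPn/eqP ->] := pselect (B !=set0).
  by apply: fine_ge0; rewrite hausdorffC; apply: hausdorff_ge0; exists b.
(* For two empty sets both suprema are [-oo], which [fine] sends to 0. *)
by rewrite /hausdorff !image_set0 ereal_sup0 maxxx.
Qed.

Lemma hdist_leP A B r : nonempty_bounded A -> nonempty_bounded B ->
  hdist A B <= r <-> excess_le A B r /\ excess_le B A r.
Proof. by move=> nA nB; rewrite -hausdorff_leP hdistE// lee_fin. Qed.

Lemma excess_le_hdist A B : nonempty_bounded A -> nonempty_bounded B ->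
  excess_le A B (hdist A B).
Proof. by move=> nA nB; have /(hdist_leP _ nA nB)[] := lexx (hdist A B). Qed.

Lemma hdist_triangle B A C : nonempty_bounded A -> nonempty_bounded B ->
  nonempty_bounded C -> hdist A C <= hdist A B + hdist B C.
Proof.
move=> nA nB nC; apply/hdist_leP => //; split.
  by apply: (@excess_le_trans B); exact: excess_le_hdist.
rewrite (hdistC A) (hdistC B C) addrC.
by apply: (@excess_le_trans B); exact: excess_le_hdist.
Qed.

Lemma hdistxx A : nonempty_bounded A -> hdist A A = 0.
Proof.
move=> nA; apply: le_anti; rewrite hdist_ge0 andbT.
by apply/hdist_leP => //; split; exact: excess_le_subset.
Qed.

End hausdorff_distance.

(** * Level sets, and their left continuity in the height *)

Section level_sets.
Context {R : realType} {m : nat}.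
Implicit Types (u v : 'rV[R]_m -> R) (a b : R).

(** The same formula at every height; it differs from [alpha_cut] only at height 0, a null set for
    the integral. *)
Definition level u a : set 'rV[R]_m := [set x | a <= u x].

Lemma alpha_cut_level u a : 0 < a -> alpha_cut u a = level u a.
Proof. by move=> a0; rewrite /alpha_cut gt_eqF. Qed.

Lemma level_subset u a b : a <= b -> level u b `<=` level u a.
Proof. by move=> ab x /(le_trans ab). Qed.

Lemma upper_semicontinuousP u :
  upper_semicontinuous u <-> forall a, closed (level u a).
Proof.
split=> [usc a x ax|cu x a uxa].
  rewrite /level/= leNgt; apply/negP => /(usc _)/ax[y []].
  by rewrite /level/= => ay; rewrite ltNge ay.
have : nbhs x (~` level u a).
  by apply: open_nbhs_nbhs; split; [exact/closed_openC|apply/negP; rewrite -ltNge].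
by apply: filterS => y /negP; rewrite -ltNge.
Qed.

(** Levels at heights [a <= 0] are the whole space and those above 1 are empty, so closedness has to
    be checked on []0, 1]] only. *)
Lemma upper_semicontinuous_levels u : is_fuzzy_set u ->
  (forall a, 0 < a <= 1 -> closed (level u a)) -> upper_semicontinuous u.
Proof.
move=> fu clu; apply/upper_semicontinuousP => a; have [a0|a0] := leP a 0.
  rewrite (_ : level u a = setT); first exact: closedT.
  apply/seteqP; split=> // x _; apply: le_trans a0 _.
  by case/andP: (fu x).
have [a1|a1] := leP a 1; first by apply: clu; rewrite a0.
rewrite (_ : level u a = set0); first exact: closed0.
apply/seteqP; split=> // x; rewrite /level/= leNgt => /negP; apply.
by apply: le_lt_trans a1; case/andP: (fu x).
Qed.

(** The working class of the proof: it contains [F_Bp], and on it levels at positive heights are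
    compact. Integrability is added later as finite distance to [origin_indic]. *)
Definition compact_levels u := [/\ is_fuzzy_set u, is_normal u,
  upper_semicontinuous u & forall a, 0 < a -> eucl_bounded (level u a)].

Lemma level_nonempty_bounded u a : compact_levels u -> 0 < a <= 1 ->
  nonempty_bounded (level u a).
Proof.
move=> [_ [x ux1] _ bu] /andP[a0 a1]; split; last exact: bu.
by exists x; rewrite /level/= ux1.
Qed.

Lemma level_compact u a : compact_levels u -> 0 < a -> compact (level u a).
Proof.
move=> [_ _ /upper_semicontinuousP cu bu] a0.
by apply: compact_eucl; [exact: bu|exact: cu].
Qed.

(** Levels decrease with the height, so only the excess of level [b] over level [a] matters. If it
    failed to become small, points at distance at least [e] from level [a], with heights bounded
    below by numbers tending to [a], would cluster by compactness; upper semicontinuity puts the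
    cluster point in level [a]. *)
Lemma level_left_continuous u a : compact_levels u -> 0 < a <= 1 ->
  forall e, 0 < e -> exists2 d, 0 < d & forall b, 0 < b -> a - d < b <= a ->
    hdist (level u b) (level u a) <= e.
Proof.
move=> cu a01 e e0; have [/= a0 a1] := andP a01.
suff [d d0 du] : exists2 d, 0 < d & forall b, a - d < b <= a ->
    excess_le (level u b) (level u a) e.
  exists d => // b b0 bda; have [_ ba] := andP bda.
  have nb : nonempty_bounded (level u b).
    by apply: level_nonempty_bounded; rewrite // b0 (le_trans ba).
  apply/hdist_leP => //; first exact: level_nonempty_bounded.
  split; first exact: du.
  by apply: excess_le_subset; [exact: ltW|exact: level_subset].
apply: contrapT => hn.
(* The gap is at most [a / 2], so all these points lie in the compact level [a / 2]. *)
have bad n : exists x, a - (a / 2) / n.+1%:R < u x /\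
    forall y, level u a y -> e <= eucl_dist x y.
  apply: contrapT => hx; apply: hn; exists ((a / 2) / n.+1%:R).
    by rewrite !divr_gt0.
  move=> b /andP[ab ba] e' e'0 x bx; apply: contrapT => hy.
  apply: hx; exists x; split; first exact: lt_le_trans ab bx.
  move=> y ay; rewrite leNgt; apply/negP => xy; apply: hy; exists y => //.
  by rewrite (lt_trans xy)// ltrDl.
have [x hx] := choice bad.
have xK n : level u (a / 2) (x n).
  have [ux _] := hx n; rewrite /level/= (le_trans _ (ltW ux))//.
  have : a / 2 / n.+1%:R <= a / 2; last by set t := _ / _.+1%:R => ?; lra.
  by rewrite ler_pdivrMr// ler_peMr ?ler1n// divr_ge0// ltW.
have [|l _ cl] := compact_seq_cluster _ xK.
  by apply: level_compact => //; rewrite divr_gt0.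
have al : level u a l.
  rewrite /level/= leNgt; apply/negP => la.
  have [_ _ usc _] := cu.
  have la2 : u l < (u l + a) / 2 by lra.
  have /nbhs_eucl_distP[r r0 hr] := usc _ _ la2.
  (* Once [k.+1%:R^-1] is below this ratio, the gap [a / 2 / k.+1%:R] is less than half of
     [a - u l], so [u (x k)] exceeds the midpoint of [u l] and [a]. *)
  have ala : 0 < (a - u l) / a by rewrite divr_gt0// subr_gt0.
  have [N _ hN] := near_infty_natSinv_lt (PosNum ala).
  have [k /hN/= + /hr ulk] := cl _ r0 N; rewrite ltr_pdivlMr// => kl.
  by have [uk _] := hx k; move: uk kl ulk; set t := k.+1%:R^-1; nra.
have [k _ lk] := cl _ e0 0%N.
by have [_ /(_ l al)] := hx k; rewrite eucl_distC leNgt lk.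
Qed.

End level_sets.

(** * Measurability of left continuous functions *)

Section left_continuous_measurable.
Context {R : realType}.

Lemma measurable_floor_comp (g : int -> R) (c : R) : 0 < c ->
  measurable_fun [set: R] (fun a => g (Num.floor (a * c))).
Proof.
move=> c0 _ Y mY; rewrite setTI.
rewrite (_ : _ @^-1` Y = \bigcup_(k in [set: int])
    [set a | Y (g k) /\ a \in `[k%:~R / c, (k + 1)%:~R / c[]); last first.
  have fl a k : (Num.floor (a * c) == k) = (a \in `[k%:~R / c, (k + 1)%:~R / c[).
    by rewrite floor_eq in_itv/= ler_pdivrMr// ltr_pdivlMr.
  apply/seteqP; split=> [a Ya|a [k _ [Yk]]].
    by exists (Num.floor (a * c)) => //; split => //; rewrite -fl.
  by rewrite -fl => /eqP ak /=; rewrite ak.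
apply: countable_bigcupT_measurable => // k.
have [Yk|Yk] := pselect (Y (g k)).
  rewrite (_ : [set _ | _] = [set` `[k%:~R / c, (k + 1)%:~R / c[]).
    exact: measurable_itv.
  by apply/seteqP; split=> [a []|a ?] //=.
by rewrite (_ : [set _ | _] = set0)//; apply/seteqP; split=> [a []|].
Qed.

(** Rounding [a] down to the grid of mesh [n.+1%:R^-1] turns [f] into a step function; as the
    rounded points approach [a] from the left, these step functions converge pointwise to [f]. *)
Lemma left_continuous_measurable (f : R -> R) :
  (forall a : R, 0 < a <= 1 -> forall e : R, 0 < e ->
     exists2 d : R, 0 < d &
     forall b : R, 0 < b -> a - d < b <= a -> `|f b - f a| <= e) ->
  measurable_fun (`]0, 1] : set R) f.
Proof.
move=> lc.
pose s n (a : R) : R := (Num.floor (a * n.+1%:R))%:~R / n.+1%:R.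
apply: (@measurable_fun_cvg _ _ _ _ (fun n a => f (s n a))).
  move=> n; apply: measurable_funTS.
  exact: (measurable_floor_comp (fun k => f (k%:~R / n.+1%:R))).
move=> a /=; rewrite in_itv/= => a01; apply/cvgrPdist_le => e e0.
have [d d0 hd] := lc a a01 _ e0; have /andP[a0 _] := a01.
(* A mesh below [a] keeps the rounded point positive, as the left continuity hypothesis requires. *)
have da0 : 0 < Num.min d a by rewrite lt_min d0.
have [N _ hN] := near_infty_natSinv_lt (PosNum da0).
exists N => // n /hN/=; rewrite lt_min => /andP[nd na].
have n0 : (0 : R) < n.+1%:R by [].
have /andP[s1 s2] := floor_itv (a * n.+1%:R).
have sa : s n a <= a by rewrite /s ler_pdivrMr.
have as1 : a < s n a + n.+1%:R^-1.
  by rewrite /s -{2}[n.+1%:R^-1]mul1r -mulrDl ltr_pdivlMr// -(intrD _ _ 1).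
move: nd na as1; set t := _.+1%:R^-1 => nd na as1.
by rewrite distrC; apply: hd; [lra|apply/andP; split => //; lra].
Qed.

End left_continuous_measurable.

(** * The distance between levels as a function of the height *)

Section level_distance.
Context {R : realType} {m : nat}.
Implicit Types (u v w : 'rV[R]_m -> R) (a b p : R).
Local Notation mu := (@lebesgue_measure R).

(** The extension by 0 outside []0, 1]] lets integrals and [L^p] norms be taken over the whole
    line. *)
Definition level_dist u v a : R :=
  if 0 < a <= 1 then hdist (level u a) (level v a) else 0.

Lemma level_dist_ge0 u v a : 0 <= level_dist u v a.
Proof. by rewrite /level_dist; case: ifP => // _; exact: hdist_ge0. Qed.

Lemma level_distC u v : level_dist u v = level_dist v u.
Proof. by apply/funext => a; rewrite /level_dist hdistC. Qed.

Lemma level_distxx u : compact_levels u -> level_dist u u = cst 0.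
Proof.
move=> cu; apply/funext => a; rewrite /level_dist; case: ifP => // a01.
by rewrite hdistxx//; exact: level_nonempty_bounded.
Qed.

Lemma level_dist_triangle v u w a :
  compact_levels u -> compact_levels v -> compact_levels w ->
  level_dist u w a <= level_dist u v a + level_dist v w a.
Proof.
move=> cu cv cw; rewrite /level_dist; case: ifP => [a01|_]; last by rewrite addr0.
by apply: hdist_triangle; exact: level_nonempty_bounded.
Qed.

Lemma level_dist_left_continuous u v a :
  compact_levels u -> compact_levels v -> 0 < a <= 1 ->
  forall e, 0 < e -> exists2 d, 0 < d & forall b, 0 < b -> a - d < b <= a ->
    `|level_dist u v b - level_dist u v a| <= e.
Proof.
move=> cu cv a01 e e0; have e20 : 0 < e / 2 by rewrite divr_gt0.
have [d1 d10 h1] := level_left_continuous cu a01 e20.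
have [d2 d20 h2] := level_left_continuous cv a01 e20.
exists (Num.min d1 d2) => [|b b0 /andP[db ba]]; first by rewrite lt_min d10.
have b01 : 0 < b <= 1 by rewrite b0 (le_trans ba)//; case/andP: a01.
have bd1 : hdist (level u b) (level u a) <= e / 2.
  apply: h1 => //; rewrite ba andbT; apply: le_lt_trans db.
  by rewrite lerD2l lerN2 ge_min lexx.
have bd2 : hdist (level v b) (level v a) <= e / 2.
  apply: h2 => //; rewrite ba andbT; apply: le_lt_trans db.
  by rewrite lerD2l lerN2 ge_min lexx orbT.
rewrite /level_dist a01 b01.
have ua := level_nonempty_bounded cu a01; have ub := level_nonempty_bounded cu b01.
have va := level_nonempty_bounded cv a01; have vb := level_nonempty_bounded cv b01.
have t1 := hdist_triangle ub ua vb; have t2 := hdist_triangle ua va vb.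
have t3 := hdist_triangle ua ub va; have t4 := hdist_triangle ub vb va.
rewrite (hdistC (level u a) (level u b)) in t3.
rewrite (hdistC (level v a) (level v b)) in t2.
by rewrite ler_norml; apply/andP; split; lra.
Qed.

Lemma measurable_level_dist u v : compact_levels u -> compact_levels v ->
  measurable_fun [set: R] (level_dist u v).
Proof.
move=> cu cv; rewrite (_ : level_dist u v = level_dist u v \_ `]0, 1]); last first.
  apply/funext => a; rewrite patchE /level_dist mem_setE in_itv/=.
  by case: ifP.
apply/(measurable_restrictT _ _).1; first exact: measurable_itv.
apply: left_continuous_measurable => a a01.
exact: level_dist_left_continuous.
Qed.

(** Identifying [d_p] with an [L^p] norm gives access to Minkowski's inequality. *)
Lemma d_p_Lnorm p u v : 1 <= p -> compact_levels u -> compact_levels v ->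
  d_p p u v = 'N[mu]_p%:E[EFin \o level_dist u v]%E.
Proof.
move=> p1 cu cv; have p0 : p != 0 by rewrite gt_eqF// (lt_le_trans _ p1).
have E a : a \in `]0%R, 1%R]%classic ->
    (hausdorff (alpha_cut u a) (alpha_cut v a) `^ p =
     `|(level_dist u v a)%:E| `^ p)%E.
  rewrite inE/= in_itv/= => a01; have /andP[a0 _] := a01.
  rewrite !alpha_cut_level// hdistE; [|exact: level_nonempty_bounded..].
  by rewrite /level_dist a01/= ger0_norm// hdist_ge0.
rewrite /d_p /lp_dist unlock; congr (_ `^ _)%E.
have mf : measurable_fun [set: R]
    (fun a : R => `|(level_dist u v a)%:E| `^ p)%E.
  apply: (@measurableT_comp _ _ _ _ _ _ (fun x => x `^ p)%E).
    exact: measurable_poweR.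
  apply: measurableT_comp => //; apply/measurable_EFinP.
  exact: measurable_level_dist.
(* This drops the height 0, where the cut is the closed support and the distance may be infinite. *)
rewrite -integral_itv_obnd_cbnd; last first.
  apply: eq_measurable_fun (measurable_funTS mf) => a aI; exact/esym/E.
transitivity (\int[mu]_(a in `]0%R, 1%R]) (`|(level_dist u v a)%:E| `^ p))%E.
  by apply: eq_integral => a aI; exact: E.
rewrite [LHS]integral_mkcond; apply: eq_integral => a _; rewrite patchE
  mem_setE in_itv/= /level_dist; case: (0 < a <= 1) => //=.
by rewrite normr0 powR0.
Qed.

End level_distance.

(** * Integral monotonicity and points of sets of full measure *)

Section lower_integral.
Local Open Scope ereal_scope.
Context d (T : measurableType d) (R : realType) (mu : {measure set T -> \bar R}).

(* The integral of a nonnegative function is a supremum over the simple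
   functions below it, so monotonicity needs no measurability. *)
Lemma ge0_le_lower_integral (D : set T) (f g : T -> \bar R) :
  (forall x, D x -> 0 <= f x) -> (forall x, D x -> f x <= g x) ->
  \int[mu]_(x in D) f x <= \int[mu]_(x in D) g x.
Proof.
move=> f0 fg; have g0 x : D x -> 0 <= g x by move=> Dx; rewrite (le_trans (f0 _ Dx)) ?fg.
rewrite !ge0_integralE//; apply: ereal_sup_le => _ [h /= hf <-]; exists h => // x.
by rewrite (le_trans (hf x))//; apply: lee_restrict.
Qed.

End lower_integral.

Section almost_everywhere.
Context {R : realType}.

(** Otherwise the interval would be negligible, while its measure is [b - a > 0]. *)
Lemma ae_itv_exists (P : set R) (a b : R) : a < b ->
  {ae @lebesgue_measure R, forall x, P x} -> exists2 x, a < x < b & P x.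
Proof.
move=> ab aeP; apply: contrapT => nP.
have /eqP : (@lebesgue_measure R) (`]a, b[ : set R) = 0%E.
  apply: measure_negligible; first exact: measurable_itv.
  apply: negligibleS aeP => x /=; rewrite in_itv/= => axb Px; apply: nP.
  by exists x.
by rewrite lebesgue_measure_itv/= lte_fin ab -EFinB eqe subr_eq0 gt_eqF.
Qed.

End almost_everywhere.

(** * Metric properties of [d_p] on fuzzy sets with compact levels *)

Section level_metric.
Context {R : realType} {m : nat} {p : R}.
Hypothesis p1 : 1 <= p.
Implicit Types (u v w : 'rV[R]_m -> R) (a b : R).
Local Notation mu := (@lebesgue_measure R).

Let p0 : 0 < p. Proof. exact: lt_le_trans p1. Qed.
Let pN0 : p != 0. Proof. by rewrite gt_eqF. Qed.

(** The p-th power of [d_p]: the convergence theorems apply to this integral, without the outer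
    root. *)
Definition pow_dist u v : \bar R := (\int[mu]_a (level_dist u v a `^ p)%:E)%E.

Lemma pow_dist_ge0 u v : (0 <= pow_dist u v)%E.
Proof. by apply: integral_ge0 => a _; rewrite lee_fin powR_ge0. Qed.

Lemma measurable_pow_dist u v : compact_levels u -> compact_levels v ->
  measurable_fun [set: R] (fun a : R => level_dist u v a `^ p).
Proof.
move=> cu cv; apply: (@measurableT_comp _ _ _ _ _ _ (@powR R ^~ p)).
  exact: measurable_powR.
exact: measurable_level_dist.
Qed.

Lemma d_pE u v : compact_levels u -> compact_levels v ->
  d_p p u v = (pow_dist u v `^ p^-1)%E.
Proof.
move=> cu cv; rewrite d_p_Lnorm// unlock; congr (_ `^ _)%E.
by apply: eq_integral => a _ /=; rewrite ger0_norm// level_dist_ge0.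
Qed.

Lemma d_p_ge0 u v : (0 <= d_p p u v)%E.
Proof. exact: poweR_ge0. Qed.

Lemma d_pC u v : d_p p u v = d_p p v u.
Proof.
by congr (_ `^ _)%E; apply: eq_integral => a _; rewrite hausdorffC.
Qed.

Lemma d_p_leP u v (e : R) : compact_levels u -> compact_levels v -> 0 <= e ->
  (d_p p u v <= e%:E)%E <-> (pow_dist u v <= (e `^ p)%:E)%E.
Proof.
move=> cu cv e0; rewrite d_pE//.
have pE : (e `^ p)%:E = (e%:E `^ p)%E by [].
have eE : (e%:E = ((e `^ p)%:E) `^ p^-1)%E.
  by rewrite poweR_EFin -powRrM divff// powRr1.
have dE : pow_dist u v = ((pow_dist u v `^ p^-1) `^ p)%E.
  by rewrite -poweRrM mulVf// poweRe1// pow_dist_ge0.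
split=> h.
  rewrite dE pE; apply: gt0_ler_poweR => //; first exact: ltW.
    by rewrite in_itv/= leey poweR_ge0.
  by rewrite in_itv/= leey lee_fin e0.
rewrite eE; apply: gt0_ler_poweR => //; first by rewrite invr_ge0 ltW.
  by rewrite in_itv/= leey pow_dist_ge0.
by rewrite in_itv/= leey lee_fin powR_ge0.
Qed.

Lemma d_p_ltyP u v : compact_levels u -> compact_levels v ->
  (d_p p u v < +oo)%E <-> (pow_dist u v < +oo)%E.
Proof.
move=> cu cv; rewrite d_pE//; split; last exact: poweR_lty.
by apply: lty_poweRy; rewrite invr_eq0.
Qed.

Lemma d_pxx u : compact_levels u -> d_p p u u = 0%E.
Proof. by move=> cu; rewrite d_p_Lnorm// level_distxx// Lnorm0// eqe. Qed.

Lemma d_p_triangle v u w :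
  compact_levels u -> compact_levels v -> compact_levels w ->
  (d_p p u w <= d_p p u v + d_p p v w)%E.
Proof.
move=> cu cv cw; rewrite !d_p_Lnorm//.
apply: le_trans (minkowski_EFin mu _ _ p1); [|exact: measurable_level_dist..].
rewrite unlock; apply: gt0_ler_poweR; first by rewrite invr_ge0 ltW.
- by rewrite in_itv/= leey integral_ge0// => a _; rewrite lee_fin powR_ge0.
- by rewrite in_itv/= leey integral_ge0// => a _; rewrite lee_fin powR_ge0.
apply: ge0_le_lower_integral => a _ /=; first by rewrite lee_fin powR_ge0.
rewrite lee_fin ge0_ler_powR ?nnegrE// ?(ltW p0)//.
rewrite !ger0_norm ?addr_ge0 ?level_dist_ge0//.
exact: level_dist_triangle.
Qed.

(** A zero norm makes [level_dist] vanish almost everywhere, left continuity makes it vanish on all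
    of []0, 1]], and closed levels at distance 0 coincide. *)
Lemma d_p_eq0 u v : compact_levels u -> compact_levels v ->
  d_p p u v = 0%E -> u = v.
Proof.
move=> cu cv; rewrite d_p_Lnorm// => /Lnorm_eq0_eq0 ae0.
have {}ae0 : {ae mu, forall a, level_dist u v a = 0}.
  apply: filterS (ae0 _ _) => [a /(_ I)[]//||].
    by apply/measurable_EFinP; exact: measurable_level_dist.
  by rewrite lte_fin.
have d0 a : 0 < a <= 1 -> level_dist u v a = 0.
  move=> a01; apply: le_anti; rewrite level_dist_ge0 andbT.
  apply/ler_addgt0Pr => e e0; rewrite add0r.
  have [d d0 hd] := level_dist_left_continuous cu cv a01 e0.
  have [a0 _] := andP a01.
  have [|b /andP[ab ba] b0] := ae_itv_exists (a := Num.max 0 (a - d)) (b := a) _ ae0.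
    by rewrite gt_max a0 ltrBlDr ltrDl.
  move: ab; rewrite gt_max => /andP[bb ab].
  have := hd b bb; rewrite ab (ltW ba) => /(_ isT).
  rewrite b0 sub0r normrN ger0_norm ?level_dist_ge0//.
have luv a : 0 < a <= 1 -> level u a = level v a.
  move=> a01; have := d0 a a01; rewrite /level_dist a01 => h.
  have [_ _ /upper_semicontinuousP clu _] := cu.
  have [_ _ /upper_semicontinuousP clv _] := cv.
  apply: hausdorff_eq0 => //; rewrite hdistE ?h//; exact: level_nonempty_bounded.
have le_of (f g : 'rV[R]_m -> R) : is_fuzzy_set f -> is_fuzzy_set g ->
    (forall a, 0 < a <= 1 -> level f a = level g a) -> forall x, f x <= g x.
  move=> ff fg lfg x; have /andP[f0 f1] := ff x.
  have [->|fN0] := eqVneq (f x) 0; first by case/andP: (fg x).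
  (* A positive value [f x] is itself a height at which [x] belongs to the level. *)
  have : level f (f x) x by exact: lexx.
  by rewrite lfg// lt_neqAle eq_sym fN0 f0.
have [fu _ _ _] := cu; have [fv _ _ _] := cv.
apply/funext => x; apply: le_anti; apply/andP; split; apply: le_of => // a a01.
exact/esym/luv.
Qed.

End level_metric.

(** * The spaces [F_B] and [F_Bp]: metric, inclusion and density *)

Section completion_spaces.
Context {R : realType} {m : nat} {p : R}.
Hypothesis p1 : 1 <= p.
Implicit Types (u v : 'rV[R]_m -> R) (a b c : R).
Local Notation mu := (@lebesgue_measure R).

Let p0 : 0 < p. Proof. exact: lt_le_trans p1. Qed.
Let pN0 : p != 0. Proof. by rewrite gt_eqF. Qed.

Let closed_origin : closed [set 0 : 'rV[R]_m].
Proof. exact/accessible_closed_set1/hausdorff_accessible/norm_hausdorff. Qed.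

Lemma hausdorff_origin_le (A : set 'rV[R]_m) (M : R) : A !=set0 ->
  (hausdorff A [set 0%R] <= M%:E)%E <-> forall x, A x -> eucl_dist x 0 <= M.
Proof.
move=> [y Ay]; rewrite hausdorff_leP; split=> [[AM _] x Ax|AM].
  by apply/ler_addgt0Pr => e /AM/(_ x Ax)[_ ->] /ltW.
split=> e e0 x => [Ax|->].
  by exists 0 => //; rewrite (le_lt_trans (AM x Ax))// ltrDl.
by exists y => //; rewrite eucl_distC (le_lt_trans (AM y Ay))// ltrDl.
Qed.

(** The origin as a fuzzy set: the integrability condition of [F_Bp] becomes finiteness of a [d_p]
    distance, to which the triangle inequality applies. *)
Definition origin_indic (x : 'rV[R]_m) : R := (x == 0)%:R.

Lemma level_origin_indic a : 0 < a <= 1 -> level origin_indic a = [set 0].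
Proof.
move=> /andP[a0 a1]; apply/seteqP; split=> x; rewrite /level/origin_indic/=.
  by case: eqP => // _ /(lt_le_trans a0); rewrite ltxx.
by move=> ->; rewrite eqxx.
Qed.

Lemma alpha_cut_origin_indic a : 0 <= a <= 1 ->
  alpha_cut origin_indic a = [set 0].
Proof.
move=> /andP[]; rewrite le_eqVlt => /predU1P[<- _|a0 a1]; last first.
  by rewrite alpha_cut_level// level_origin_indic// a0.
rewrite /alpha_cut eqxx (_ : [set x | _] = [set 0]).
  by rewrite -(closure_id _).1//; exact: closed_origin.
apply/seteqP; split=> x; rewrite /origin_indic/=; last by move=> ->; rewrite eqxx.
by case: eqP => //; rewrite ltxx.
Qed.

Lemma compact_levels_origin_indic : compact_levels origin_indic.
Proof.
have fo : is_fuzzy_set origin_indic.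
  by move=> x; rewrite /origin_indic; case: eqP; rewrite ?ler01 ?lexx.
split => //.
- by exists 0; rewrite /origin_indic eqxx.
- apply: upper_semicontinuous_levels => // a a01.
  by rewrite level_origin_indic//; exact: closed_origin.
- move=> a a0; exists 0 => x; rewrite /level/origin_indic/=.
  case: eqP => [-> _|_ /(lt_le_trans a0)]; first by rewrite eucl_distxx.
  by rewrite ltxx.
Qed.

Lemma lp_dist_origin u :
  lp_dist p (alpha_cut u) (fun=> [set 0%R]) = d_p p u origin_indic.
Proof.
rewrite /d_p /lp_dist; apply: (congr1 (fun z => z `^ p^-1)%E).
apply: eq_integral => a; rewrite inE/= in_itv/= => a01.
by rewrite alpha_cut_origin_indic.
Qed.

Lemma alpha_cut_nonempty u a : is_normal u -> 0 <= a <= 1 ->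
  alpha_cut u a !=set0.
Proof.
move=> [x ux1] /andP[]; rewrite le_eqVlt => /predU1P[<- _|a0 a1].
  rewrite /alpha_cut eqxx; exists x; apply: subset_closure => /=.
  by rewrite ux1 ltr01.
by exists x; rewrite alpha_cut_level// /level/= ux1.
Qed.

(** If the level at [a] is unbounded, so are all lower ones; the integrand is then [+oo] on []0,
    a]], which has positive measure. *)
Lemma F_Bp_compact_levels u : F_Bp p u -> compact_levels u.
Proof.
move=> [fu nu usc]; rewrite /lp_dist => ltoo; split => // a a0.
have [a1|a1] := leP a 1; last first.
  exists 0 => x; rewrite /level/= leNgt => /negP[]; apply: le_lt_trans a1.
  by case/andP: (fu x).
apply: contrapT => unb.
have Hoo b : 0 < b <= a -> hausdorff (alpha_cut u b) [set 0] = +oo%E.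
  move=> /andP[b0 ba]; apply: contrapT => /eqP; rewrite -ltey => Hlt; apply: unb.
  have b01 : 0 <= b <= 1 by rewrite ltW// (le_trans ba).
  have ne := alpha_cut_nonempty nu b01.
  exists (fine (hausdorff (alpha_cut u b) [set 0])) => x ax.
  apply: ((hausdorff_origin_le _ ne).1 _).
    by rewrite fineK// ge0_fin_numE// hausdorff_ge0.
  by rewrite alpha_cut_level//; apply: level_subset ax.
have := lty_poweRy _ ltoo; rewrite invr_eq0 => /(_ pN0).
rewrite ltNge => /negP; apply; rewrite leye_eq -leye_eq.
apply: (@le_trans _ _ (\int[mu]_(b in `]0%R, a]) (cst +oo b))%E).
  rewrite integral_cst; last exact: measurable_itv.
  rewrite /= lebesgue_measure_itv/= lte_fin a0 sube0 gt0_mulye//.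
rewrite integral_mkcond [leRHS]integral_mkcond.
apply: ge0_le_lower_integral => b _; rewrite !patchE !mem_setE !in_itv/=.
  by case: ifP.
case: ifP => [/andP[b0 ba]|_].
  by rewrite (ltW b0) (le_trans ba)//= Hoo ?b0// poweRyr.
by case: ifP => // _; exact: poweR_ge0.
Qed.

Lemma F_BpP u : F_Bp p u <->
  compact_levels u /\ (d_p p u origin_indic < +oo)%E.
Proof.
split=> [Fu|[[fu nu usc _] ltoo]]; last first.
  split; [exact: fu|exact: nu|exact: usc|].
  rewrite lp_dist_origin; exact: ltoo.
split; first exact: F_Bp_compact_levels.
rewrite -lp_dist_origin; have [_ _ _ ltoo] := Fu; exact: ltoo.
Qed.

Lemma alpha_cut_subset0 u a : 0 <= a -> alpha_cut u a `<=` alpha_cut u 0.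
Proof.
rewrite le_eqVlt => /predU1P[<-//|a0] x; rewrite alpha_cut_level// => ax.
by rewrite /alpha_cut eqxx; apply: subset_closure; exact: lt_le_trans a0 ax.
Qed.

(** A bound [M] on the support bounds every cut, so the integrand is at most [M ^ p] on an interval
    of length 1. *)
Lemma F_B_sub_F_Bp : @F_B R m `<=` @F_Bp R m p.
Proof.
move=> u [fu nu usc [M uM]]; split => //; apply: poweR_lty.
apply: (@le_lt_trans _ _ (\int[mu]_(a in `[0%R, 1%R]) cst (M `^ p)%:E a)%E).
  apply: ge0_le_lower_integral => a; first by rewrite poweR_ge0.
  rewrite /= in_itv/= => a01; rewrite -poweR_EFin.
  have ne := alpha_cut_nonempty nu a01; have [a0 _] := andP a01.
  have HM : (hausdorff (alpha_cut u a) [set 0%R] <= M%:E)%E.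
    apply/(hausdorff_origin_le _ ne) => x /(alpha_cut_subset0 a0); exact: uM.
  apply: gt0_ler_poweR => //; first exact: ltW.
    by rewrite in_itv/= leey hausdorff_ge0.
  by rewrite in_itv/= leey (le_trans _ HM)// hausdorff_ge0.
rewrite integral_cst; last exact: measurable_itv.
by rewrite /= lebesgue_measure_itv/= lte_fin ltr01 oppr0 adde0 mule1 ltry.
Qed.

Lemma metric_on_F_Bp : metric_on (@F_Bp R m p) (d_p p).
Proof.
split=> [u v|u v|u v _ _|u v w].
- move=> /F_BpP[cu ou] /F_BpP[cv ov]; split; last exact: d_p_ge0.
  rewrite ge0_fin_numE; last exact: d_p_ge0.
  apply: le_lt_trans (d_p_triangle p1 cu compact_levels_origin_indic cv) _.
  rewrite (d_pC origin_indic); exact: lte_add_pinfty ou ov.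
- move=> /F_Bp_compact_levels cu /F_Bp_compact_levels cv.
  split=> [|<-]; first exact: d_p_eq0.
  exact: d_pxx.
- exact: d_pC.
- move=> /F_Bp_compact_levels cu /F_Bp_compact_levels cv /F_Bp_compact_levels cw.
  exact: d_p_triangle.
Qed.

(** Truncation confines the support to the bounded level [c] of [u] and leaves the levels at heights
    [a >= c] unchanged. *)
Definition fuzzy_trunc c u : 'rV[R]_m -> R := fun x => if c <= u x then u x else 0.

Lemma level_fuzzy_trunc c u a : 0 < a ->
  level (fuzzy_trunc c u) a = level u (Num.max c a).
Proof.
move=> a0; apply/seteqP; split=> x; rewrite /level/fuzzy_trunc/= ge_max.
  by case: ifP => // _ /(lt_le_trans a0); rewrite ltxx.
by move=> /andP[-> ->].
Qed.

Lemma F_B_fuzzy_trunc c u : 0 < c <= 1 -> compact_levels u ->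
  F_B (fuzzy_trunc c u).
Proof.
move=> /andP[c0 c1] [fu [x ux1] usc bu].
have ft : is_fuzzy_set (fuzzy_trunc c u).
  by move=> y; rewrite /fuzzy_trunc; case: ifP => // _; rewrite lexx ler01.
split => //.
- by exists x; rewrite /fuzzy_trunc ux1 c1.
- apply: upper_semicontinuous_levels => // a /andP[a0 _].
  by rewrite level_fuzzy_trunc//; move/upper_semicontinuousP : usc; exact.
- have [M uM] := bu c c0; exists M => y; rewrite /alpha_cut eqxx => yc.
  apply: uM; move/upper_semicontinuousP : usc => /(_ c); apply => U /yc[z [+ Uz]].
  rewrite /fuzzy_trunc/=; case: ifP => [cz _|]; last by rewrite ltxx.
  by exists z.
Qed.

(** For [a < c], compare both levels with the origin; level [c] lies inside level [a], hence is no
    farther from the origin. The factor 2 yields a dominating function independent of [c]. *)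
Lemma level_dist_fuzzy_trunc c u a : 0 < c <= 1 -> compact_levels u ->
  level_dist (fuzzy_trunc c u) u a <=
    if a < c then 2 * level_dist u origin_indic a else 0.
Proof.
move=> /andP[c0 c1] cu; rewrite /level_dist.
case: ifPn => [a01|_]; last by rewrite mulr0 if_same.
have [a0 a1] := andP a01; rewrite level_fuzzy_trunc// level_origin_indic//.
have [ac|ca] := ltP a c; last first.
  by rewrite hdistxx//; exact: level_nonempty_bounded.
have c01 : 0 < c <= 1 by rewrite c0.
have nc := level_nonempty_bounded cu c01; have na := level_nonempty_bounded cu a01.
have n0 : nonempty_bounded [set 0 : 'rV[R]_m].
  rewrite -(level_origin_indic a01).
  exact: level_nonempty_bounded compact_levels_origin_indic a01.
apply: le_trans (hdist_triangle nc n0 na) _.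
rewrite (hdistC [set 0]) mulr_natl mulr2n lerD2r.
rewrite -lee_fin -hdistE//; apply/hausdorff_origin_le; first by case: nc.
move=> x /(level_subset (ltW ac)); move: x.
by apply/hausdorff_origin_le; [case: na|rewrite hdistE].
Qed.

Lemma F_B_dense : dense_in (@F_B R m) (@F_Bp R m p) (d_p p).
Proof.
move=> u /F_BpP[cu ou] e e0.
have c01 n : 0 < (n.+1%:R^-1 : R) <= 1.
  by rewrite invr_gt0 ltr0n/= invf_le1// ler1n.
pose t n := fuzzy_trunc n.+1%:R^-1 u.
have Ft n : F_B (t n) by exact: F_B_fuzzy_trunc.
have ct n : compact_levels (t n).
  exact: F_Bp_compact_levels (F_B_sub_F_Bp (Ft n)).
pose g a := ((2 `^ p)%:E * (level_dist u origin_indic a `^ p)%:E)%E.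
have co := compact_levels_origin_indic.
have ig : mu.-integrable setT g.
  apply: integrableZl => //; apply/integrableP; split.
    by apply/measurable_EFinP; exact: measurable_pow_dist.
  under eq_integral => a _ do rewrite gee0_abs ?lee_fin ?powR_ge0//.
  exact/d_p_ltyP.
have cvg0 : (\int[mu]_a (level_dist (t n) u a `^ p)%:E)%E @[n --> \oo] --> (\int[mu]_a cst 0 a)%E.
  apply: (@dominated_cvg _ _ _ mu setT measurableT _ (cst 0%E) g) => //.
  - by move=> n; apply/measurable_EFinP; exact: measurable_pow_dist.
  (* At a fixed height [a > 0] the distance is exactly 0 once [n.+1%:R^-1 < a]. *)
  - move=> a _; apply: cvg_near_cst.
    have [a0|a0] := leP a 0.
      by apply: nearW => n; rewrite /level_dist ltNge a0 powR0.
    have [N _ hN] := near_infty_natSinv_lt (PosNum a0).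
    exists N => // n /hN/= na.
    have := level_dist_fuzzy_trunc a (c01 n) cu; rewrite ltNge (ltW na)/= => d0.
    rewrite (_ : level_dist _ _ _ = 0) ?powR0//.
    by apply: le_anti; rewrite d0 level_dist_ge0.
  - move=> n a _; rewrite gee0_abs ?lee_fin ?powR_ge0//.
    rewrite -powRM ?level_dist_ge0// ge0_ler_powR ?nnegrE ?(ltW p0)//.
    + exact: level_dist_ge0.
    + by rewrite mulr_ge0 ?level_dist_ge0.
    apply: le_trans (level_dist_fuzzy_trunc _ (c01 n) cu) _.
    by case: ifP => // _; rewrite mulr_ge0 ?level_dist_ge0.
rewrite integral_cst// mul0e in cvg0.
apply: contrapT => far.
(* If no truncation were closer than [e], all the integrals would stay above this constant, against
   their limit 0. Halving [e] makes up for the non-strict bound of [d_p_leP]. *)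
have e2p : 0 < (e / 2) `^ p by rewrite powR_gt0// divr_gt0.
have : (((e / 2) `^ p)%:E <= 0)%E.
  apply: cvge_ge cvg0; apply: nearW => n; rewrite leNgt; apply/negP => lt.
  apply: far; exists (t n) => //.
  apply: (@le_lt_trans _ _ (e / 2)%:E); last first.
    by rewrite lte_fin gtr_pMr// invf_lt1// ltr1n.
  apply/d_p_leP => //; first by rewrite divr_ge0// ltW.
  exact: ltW.
by rewrite lee_fin leNgt e2p.
Qed.

End completion_spaces.

(** * Limits of geometrically convergent sequences of sets *)

Section lower_limits.
Context {R : realType} {m : nat}.
Implicit Types (A B : nat -> set 'rV[R]_m) (C e : R).

(** The Kuratowski lower limit, which is the Hausdorff limit under the geometric bound assumed
    below. *)
Definition lower_limit A : set 'rV[R]_m := [set x | forall e, 0 < e ->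
  exists N, forall k, (N <= k)%N -> exists2 y, A k y & eucl_dist x y < e].

Lemma lower_limit_subset A B : (forall k, A k `<=` B k) ->
  lower_limit A `<=` lower_limit B.
Proof.
move=> AB x Ax e /Ax[N hN]; exists N => k /hN[y /AB By xy].
by exists y.
Qed.

Lemma closed_lower_limit A : closed (lower_limit A).
Proof.
move=> x clx e e0; have e20 : 0 < e / 2 by rewrite divr_gt0.
have [|z [Az xz]] := clx [set z | eucl_dist x z < e / 2].
  by apply/nbhs_eucl_distP; exists (e / 2).
have [N hN] := Az _ e20; exists N => k /hN[y Ay zy]; exists y => //.
by rewrite (le_lt_trans (eucl_dist_triangle z _ _))// [e]splitr ltrD.
Qed.

Variables (A : nat -> set 'rV[R]_m) (C : R).
Hypothesis nA : forall k, nonempty_bounded (A k).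
Hypothesis AC : forall k, hdist (A k) (A k.+1) <= C * 2^-1 ^+ k.

Let C0 : 0 <= C.
Proof. by have := AC 0; rewrite expr0 mulr1; apply: le_trans; exact: hdist_ge0. Qed.

(** The right side is the exact partial geometric sum, a form that closes the induction. *)
Let hdist_chain k n :
  hdist (A k) (A (k + n)%N) <= 2 * C * (2^-1 ^+ k - 2^-1 ^+ (k + n)).
Proof.
elim: n => [|n IHn]; first by rewrite addn0 subrr mulr0 hdistxx.
apply: le_trans (hdist_triangle (nA k) (nA (k + n)) (nA _)) _.
by have := AC (k + n); rewrite addnS exprS; lra.
Qed.

(** Starting from [a], pick successive points [z i] in [A (k + i)], each close to the previous one.
    The steps are summable, so [z] is Cauchy, and its limit lies in the lower limit, near [a]. *)
Lemma excess_le_lower_limit k :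
  excess_le (A k) (lower_limit A) (2 * (C + 1) * 2^-1 ^+ k).
Proof.
move=> e e0 a Aka.
(* The next point is chosen for every pair, with [b] itself as default outside [A j]. [C + 1]
   absorbs the slack [2^-1 ^+ j] of an infimum that may not be attained. *)
have /choice[f hf] : forall jb : nat * 'rV[R]_m, exists c, A jb.1 jb.2 ->
    A jb.1.+1 c /\ eucl_dist jb.2 c < (C + 1) * 2^-1 ^+ jb.1.
  move=> [j b] /=.
  have [Ajb|nAjb] := pselect (A j b); last by exists b.
  have j0 : 0 < (2^-1 : R) ^+ j by rewrite exprn_gt0.
  have [c Ac bc] := excess_le_hdist (nA j) (nA j.+1) j0 Ajb.
  by exists c => _; split=> //; apply: lt_le_trans bc _; have := AC j; lra.
pose z := fix z i := if i is i'.+1 then f ((k + i')%N, z i') else a.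
have Az i : A (k + i)%N (z i).
  by elim: i => [|i IHi]; rewrite ?addn0// addnS; apply: (hf (_, _) IHi).1.
have zz i n : eucl_dist (z i) (z (i + n)%N) <=
    2 * (C + 1) * (2^-1 ^+ (k + i) - 2^-1 ^+ (k + (i + n))).
  elim: n => [|n IHn]; first by rewrite addn0 eucl_distxx subrr mulr0.
  apply: le_trans (eucl_dist_triangle (z (i + n)%N) _ _) _.
  have [_ /=] := hf (_, _) (Az (i + n)%N).
  by rewrite !addnS exprS/=; lra.
have zz' i j : (i <= j)%N -> eucl_dist (z i) (z j) <= 2 * (C + 1) * 2^-1 ^+ (k + i).
  move=> /subnKC <-; apply: le_trans (zz _ _) _; rewrite ler_wpM2l//.
    by rewrite mulr_ge0// addr_ge0.
  by rewrite lerBlDr lerDl exprn_ge0.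
have D0 : 0 < 2 * (C + 1) by rewrite mulr_gt0// ltr_wpDl.
have small e' : 0 < e' -> exists N, forall i, (N <= i)%N ->
    2 * (C + 1) * 2^-1 ^+ (k + i) < e'.
  move=> e'0; have ed : 0 < e' / (2 * (C + 1)) by rewrite divr_gt0.
  have [N _ hN] := near_infty_natSinv_expn_lt (PosNum ed); exists N => i Ni.
  have := hN (k + i)%N (leq_trans Ni (leq_addl _ _)).
  by rewrite /= ltr_pdivlMr// mul1r exprVn mulrC.
have [l hl] : exists l, forall e, 0 < e ->
    exists N, forall i, (N <= i)%N -> eucl_dist l (z i) < e.
  apply: eucl_cauchy_cvg => e' e'0; have e2 : 0 < e' / 2 by rewrite divr_gt0.
  have [N hN] := small _ e2; exists N => i j Ni Nj.
  apply: le_lt_trans (eucl_dist_triangle (z N) _ _) _; rewrite eucl_distC.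
  by move: (hN N (leqnn _)) (zz' _ _ Ni) (zz' _ _ Nj) => *; lra.
exists l.
  move=> e' e'0; have [N hN] := hl _ e'0; exists (k + N)%N => j kNj.
  exists (z (j - k)%N); last first.
    by apply: hN; rewrite leq_subRL// (leq_trans _ kNj)// leq_addr.
  by have := Az (j - k)%N; rewrite subnKC// (leq_trans _ kNj)// leq_addr.
have e20 : 0 < e / 2 by rewrite divr_gt0.
have [N hN] := hl _ e20; apply: le_lt_trans (eucl_dist_triangle (z N) _ _) _.
have := hN N (leqnn _); rewrite eucl_distC => ?.
by have := zz' 0 N (leq0n _); rewrite addn0/= => ?; lra.
Qed.

(** Approximate [x] by a point of some late [A (k + N)], then come back to [A k] along the chain
    bound. *)
Lemma lower_limit_excess_le k :
  excess_le (lower_limit A) (A k) (2 * (C + 1) * 2^-1 ^+ k).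
Proof.
move=> e e0 x limx; have e20 : 0 < e / 2 by rewrite divr_gt0.
have [N hN] := limx _ e20; have [y Ay xy] := hN (k + N)%N (leq_addl _ _).
have [b Ab yb] := excess_le_hdist (nA (k + N)) (nA k) e20 Ay.
exists b => //; apply: le_lt_trans (eucl_dist_triangle y _ _) _.
have := hdist_chain k N; rewrite hdistC => ?.
have k0 : 0 <= (2^-1 : R) ^+ k by rewrite exprn_ge0.
have kN0 : 0 <= C * (2^-1 : R) ^+ (k + N) by rewrite mulr_ge0 ?exprn_ge0.
lra.
Qed.

Lemma nonempty_bounded_lower_limit : nonempty_bounded (lower_limit A).
Proof.
have [[a Aa] [M AM]] := nA 0; split.
  by have [l] := excess_le_lower_limit ltr01 Aa; exists l.
exists (2 * (C + 1) * 2^-1 ^+ 0 + 1 + M) => x limx.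
have [b /AM b0 xb] := lower_limit_excess_le 0 ltr01 limx.
by apply: le_trans (eucl_dist_triangle b _ _) _; rewrite lerD// ltW.
Qed.

Lemma hdist_lower_limit k :
  hdist (A k) (lower_limit A) <= 2 * (C + 1) * 2^-1 ^+ k.
Proof.
apply/hdist_leP => //; first exact: nonempty_bounded_lower_limit.
by split; [exact: excess_le_lower_limit|exact: lower_limit_excess_le].
Qed.

End lower_limits.

Lemma cauchy_fast_subsequence (R : realType) (T : Type) (d : T -> T -> \bar R)
    (x : nat -> T) (e : nat -> R) : (forall k, 0 < e k) -> cauchy_seq d x ->
  exists n : nat -> nat, (forall k, (k <= n k)%N) /\
    forall k, (d (x (n k)) (x (n k.+1)) < (e k)%:E)%E.
Proof.
move=> e0 cx; have /choice[N hN] : forall k, exists N, forall i j : nat,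
    (N <= i)%N -> (N <= j)%N -> (d (x i) (x j) < (e k)%:E)%E.
  by move=> k; exact: cx.
(* Partial sums dominate each [N k] and are monotone; the successor in each term ensures
   [k <= n k]. *)
pose n k := (\sum_(j < k.+1) (N j).+1)%N.
have nN k : (N k <= n k)%N.
  by rewrite /n big_ord_recr/= (leq_trans (leqnSn _))// leq_addl.
exists n; split=> k; last first.
  by apply: hN => //; rewrite /n big_ord_recr/= (leq_trans (nN k))// leq_addr.
apply: (@leq_trans k.+1) => //.
rewrite -[leqLHS]card_ord -sum1_card; exact: leq_sum.
Qed.

(** * From summable norms to geometric decay almost everywhere *)

Section almost_everywhere_geometric.
Context {R : realType}.
Local Notation mu := (@lebesgue_measure R).

(* Integrating [\sum_k (2 ^ k * f k) ^ p] term by term replaces a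
   Borel-Cantelli argument. *)
Lemma ae_geometric_bound (p : R) (f : nat -> R -> R) : 1 <= p ->
  (forall k a, 0 <= f k a) -> (forall k, measurable_fun [set: R] (f k)) ->
  (forall k, (\int[mu]_a (f k a `^ p)%:E <= ((4^-1 ^+ k) `^ p)%:E)%E) ->
  {ae mu, forall a, exists C, forall k, f k a <= C * 2^-1 ^+ k}.
Proof.
move=> p1 f0 mf intf; have p0 : 0 < p by exact: lt_le_trans p1.
pose g (k : nat) (a : R) : \bar R := (((2 ^+ k) `^ p)%:E * (f k a `^ p)%:E)%E.
have mfp k : measurable_fun [set: R] (fun a : R => (f k a `^ p)%:E).
  apply/measurable_EFinP; apply: (@measurableT_comp _ _ _ _ _ _ (@powR R ^~ p)).
    exact: measurable_powR.
  exact: mf.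
have g0 k (a : R) : (0 <= g k a)%E by rewrite /g -EFinM lee_fin mulr_ge0 ?powR_ge0.
have mg k : measurable_fun [set: R] (g k).
  by apply: emeasurable_funM => //; exact: measurable_cst.
have mS : measurable_fun [set: R] (fun a : R => \sum_(k <oo) g k a)%E.
  exact: (ge0_emeasurable_sum (P := xpredT)).
have intg k : (\int[mu]_a g k a <= (2^-1 ^+ k)%:E)%E.
  rewrite ge0_integralZl_EFin ?powR_ge0//;
    [|by move=> a _; rewrite lee_fin powR_ge0|exact: mfp].
  apply: le_trans (lee_wpmul2l _ (intf k)) _; first by rewrite lee_fin powR_ge0.
  rewrite -EFinM lee_fin -powRM ?exprn_ge0// -exprMn.
  rewrite (_ : 2 * 4^-1 = 2^-1 :> R); last by field.
  (* The weight [2 ^+ k] turns [4^-1 ^+ k] into [2^-1 ^+ k]; this is at most 1, so raising it to the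
     power [p >= 1] does not increase it. *)
  rewrite -[leRHS]powRr1 ?exprn_ge0// ger_powR// exprn_gt0//=.
  by rewrite exprn_ile1// invf_le1// ler1n.
have intS : (\int[mu]_a (\sum_(k <oo) g k a) < +oo)%E.
  rewrite integral_nneseries//.
  have le_sum : (\sum_(k <oo) \int[mu]_a g k a <= \sum_(k <oo) (2^-1 ^+ k)%:E)%E.
    apply: lee_nneseries => [i _ _|i _]; last exact: intg.
    by apply: integral_ge0 => a _; exact: g0.
  apply: le_lt_trans le_sum _.
  apply: le_lt_trans (ltry 2); apply: lime_le.
    by apply: is_cvg_nneseries => k _ _; rewrite lee_fin exprn_ge0.
  apply: nearW => n; rewrite sumEFin lee_fin.
  suff -> : \sum_(0 <= k < n) (2^-1 : R) ^+ k = 2 - 2 * 2^-1 ^+ n.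
    by rewrite lerBlDr lerDl mulr_ge0// exprn_ge0.
  elim: n => [|n IHn]; first by rewrite big_nil expr0 mulr1 subrr.
  by rewrite big_nat_recr//= IHn exprS; lra.
have iS : mu.-integrable [set: R] (fun a : R => \sum_(k <oo) g k a)%E.
  apply/integrableP; split => //; apply: le_lt_trans intS.
  apply: ge0_le_lower_integral => a _; first exact: abse_ge0.
  by rewrite gee0_abs// nneseries_ge0.
apply: filterS (integrable_ae measurableT iS) => a /(_ I) finS.
(* Each term is at most the finite sum, so the p-th root of the sum bounds all [2 ^+ k * f k a]. *)
exists (fine (\sum_(k <oo) g k a)%E `^ p^-1) => k.
have gS : (g k a <= \sum_(k <oo) g k a)%E.
  apply: le_trans (nneseries_lim_ge k.+1 _) => [|//].
  by rewrite big_nat_recr//= leeDr// sume_ge0.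
move: gS; rewrite -{1}(fineK finS); set s := fine _.
rewrite /g -EFinM lee_fin -powRM ?exprn_ge0// => gs.
rewrite exprVn ler_pdivlMr ?exprn_gt0// mulrC.
have kf0 : 0 <= 2 ^+ k * f k a by rewrite mulr_ge0// exprn_ge0.
have -> : 2 ^+ k * f k a = ((2 ^+ k * f k a) `^ p) `^ p^-1.
  by rewrite -powRrM divff ?gt_eqF// powRr1.
rewrite ge0_ler_powR ?nnegrE ?invr_ge0 ?powR_ge0 ?(ltW p0)//.
exact: le_trans (powR_ge0 _ _) gs.
Qed.

End almost_everywhere_geometric.

(** * A countable base of balls and the countability of jumps *)

Section rational_balls.
Context {R : realType} {m : nat}.
Implicit Types (x : 'rV[R]_m).

Definition rat_ball (q : 'rV[rat]_m * nat) : set 'rV[R]_m :=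
  [set y | eucl_dist (map_mx ratr q.1) y < q.2.+1%:R^-1].

Lemma rat_ball_basis x (e : R) : 0 < e ->
  exists2 q, rat_ball q x & forall y, rat_ball q y -> eucl_dist x y < e.
Proof.
move=> e0; have e20 : 0 < e / 2 by rewrite divr_gt0.
have [N _ /(_ N (leqnn N))/= hN] := near_infty_natSinv_lt (PosNum e20).
pose s : R := N.+1%:R^-1; have s0 : 0 < s by rewrite invr_gt0.
(* Coordinates within [t] give a Euclidean distance at most [m%:R * t < s]. *)
pose t := s / m.+1%:R; have t0 : 0 < t by rewrite divr_gt0.
have /choice[c hc] : forall i, exists q : rat, ratr q \in `]x 0 i - t, x 0 i + t[.
  by move=> i; apply: rat_in_itvoo; lra.
pose cx : 'rV[rat]_m := \row_i c i.
have cxx : eucl_dist (map_mx ratr cx) x < s.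
  apply: le_lt_trans (eucl_dist_le_norm _ _) _.
  apply: (@le_lt_trans _ _ (m%:R * t)).
    rewrite ler_wpM2l// [leLHS]/Num.norm/= mx_normrE.
    apply/bigmax_leP => /=; split=> [|[i j] _]; first exact: ltW.
    rewrite (ord1 i) !mxE/= distrC ler_distl.
    by have := hc j; rewrite in_itv/= => /andP[? ?]; apply/andP; split; lra.
  by rewrite /t mulrCA gtr_pMr// ltr_pdivrMr// mul1r ltr_nat.
exists (cx, N) => // y yc.
apply: le_lt_trans (eucl_dist_triangle (map_mx ratr cx) _ _) _.
by rewrite eucl_distC [e]splitr ltrD// ?(lt_trans _ hN).
Qed.

(* A jump of [K] at [a] is witnessed by a rational ball meeting [K b] exactly
   for the [b] in [P] below [a]; the ball then determines [a] as a supremum. *)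
Lemma countable_jumps (P : set R) (K : R -> set 'rV[R]_m) :
  (forall a, P a -> forall c, c < a -> exists2 b, c < b < a & P b) ->
  (forall a, closed (K a)) ->
  (forall a b, a <= b -> K b `<=` K a) ->
  countable [set a | P a /\ exists2 x, ~ K a x &
    forall b, P b -> b < a -> K b x].
Proof.
move=> dP cK dK; pose s q := sup [set b | P b /\ K b `&` rat_ball q !=set0].
apply: (@sub_countable _ _ _ (s @` [set: 'rV[rat]_m * nat])).
  apply: subset_card_le => a [Pa [x nKax Kx]].
  have [e e0 xe] : exists2 e : R, 0 < e & forall y, K a y -> ~ eucl_dist x y < e.
    apply: contrapT => far; apply: nKax; apply: closed_eucl => // e e0.
    apply: contrapT => near; apply: far; exists e => // y Kay xy; apply: near.
    by exists y.
  have [q qx qe] := rat_ball_basis x e0; exists q => //.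
  have ub : ubound [set b | P b /\ K b `&` rat_ball q !=set0] a.
    move=> b [Pb [y [Kby qy]]]; rewrite leNgt; apply/negP => ab.
    by apply: (xe y); [exact: dK (ltW ab) _ Kby|exact: qe].
  have below c : c < a ->
      exists2 b, c < b & [set b | P b /\ K b `&` rat_ball q !=set0] b.
    move=> /(dP _ Pa)[b /andP[cb ba] Pb]; exists b => //.
    by split => //; exists x; split => //; exact: Kx.
  have [b0 _ Sb0] := below (a - 1) ltac:(by rewrite ltrBlDr ltrDl).
  apply: le_anti; apply/andP; split; first by apply: ge_sup; [exists b0|].
  rewrite leNgt; apply/negP => /below[b sb Sb].
  by move: sb; rewrite ltNge ub_le_sup//; exists a.
apply: card_le_trans (card_image_le _ _) _; exact: countableP.
Qed.

End rational_balls.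

(** * Construction of the limit fuzzy set from its levels *)

Section limit_fuzzy_set.
Context {R : realType} {m : nat}.
Local Notation mu := (@lebesgue_measure R).
Variable y : nat -> 'rV[R]_m -> R.
Hypothesis cy : forall k, compact_levels (y k).
Hypothesis aeP : {ae mu, forall a, exists C, forall k,
  level_dist (y k) (y k.+1) a <= C * 2^-1 ^+ k}.

(** The good heights: they have full measure in []0, 1]], hence are dense there. *)
Let P : set R := [set a | 0 < a <= 1 /\ exists C, forall k,
  level_dist (y k) (y k.+1) a <= C * 2^-1 ^+ k].

Let K (a : R) : set 'rV[R]_m := lower_limit (fun k => level (y k) a).

Let P_dense (c a : R) : 0 < a <= 1 -> c < a -> exists2 b, c < b < a & P b.
Proof.
move=> /andP[a0 a1] ca.
have [|b /andP[cb ba] hb] := ae_itv_exists (a := Num.max 0 c) (b := a) _ aeP.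
  by rewrite gt_max a0.
move: cb; rewrite gt_max => /andP[b0 cb]; exists b; first by rewrite cb.
by split=> //; rewrite b0 (le_trans (ltW ba)).
Qed.

Let K_closed a : closed (K a). Proof. exact: closed_lower_limit. Qed.

Let K_subset a b : a <= b -> K b `<=` K a.
Proof. by move=> ab; apply: lower_limit_subset => k; exact: level_subset. Qed.

Let K_approx a : P a -> nonempty_bounded (K a) /\
  exists C, forall k, hdist (level (y k) a) (K a) <= C * 2^-1 ^+ k.
Proof.
move=> [a01 [C hC]].
have nA k : nonempty_bounded (level (y k) a) by exact: level_nonempty_bounded.
have AC k : hdist (level (y k) a) (level (y k.+1) a) <= C * 2^-1 ^+ k.
  by have := hC k; rewrite /level_dist a01.
split; first exact: nonempty_bounded_lower_limit nA AC.
by exists (2 * (C + 1)) => k; exact: (hdist_lower_limit nA AC).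
Qed.

(** Adjoining 0 keeps the set nonempty and gives the value 0 to points lying in no [K b]. *)
Definition limit_fuzzy (x : 'rV[R]_m) : R :=
  sup ([set 0] `|` [set b | P b /\ K b x]).

Let limit_fuzzy_ubound x : ubound ([set 0] `|` [set b | P b /\ K b x]) 1.
Proof. by move=> b [->|[[/andP[_ b1] _] _]]. Qed.

Let le_limit_fuzzy a x : P a -> K a x -> a <= limit_fuzzy x.
Proof.
move=> Pa Kax; apply: ub_le_sup; first by exists 1; exact: limit_fuzzy_ubound.
by right.
Qed.

Let is_fuzzy_limit : is_fuzzy_set limit_fuzzy.
Proof.
move=> x; apply/andP; split.
  apply: ub_le_sup; first by exists 1; exact: limit_fuzzy_ubound.
  by left.
by apply: ge_sup; [exists 0; left|exact: limit_fuzzy_ubound].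
Qed.

Let limit_level_sub a b : P b -> b < a -> level limit_fuzzy a `<=` K b.
Proof.
move=> Pb ba x ax.
have [|c [->|[Pc Kcx]] bc] :=
    @sup_gt _ ([set 0] `|` [set b | P b /\ K b x]) b _ (lt_le_trans ba ax).
- by exists 0; left.
- by have [/andP[b0 _] _] := Pb; move: (lt_trans b0 bc); rewrite ltxx.
- exact: K_subset (ltW bc) _ Kcx.
Qed.

Let limit_level a : 0 < a <= 1 ->
  level limit_fuzzy a = [set x | forall b, P b -> b < a -> K b x].
Proof.
move=> a01; apply/seteqP; split=> x.
  by move=> ax b Pb ba; exact: limit_level_sub Pb ba _ ax.
move=> Kx; rewrite /level/= leNgt; apply/negP => xa.
have [b /andP[xb ba] Pb] := P_dense a01 xa.
by move: xb; rewrite ltNge le_limit_fuzzy//; exact: Kx.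
Qed.

(** Take points of [K b] for good heights [b] tending to 1. They stay in one compact set, and a
    cluster point lies in every [K c] with [c] good and below 1, so its value is 1. *)
Let is_normal_limit : is_normal limit_fuzzy.
Proof.
have a01 : 0 < (1 : R) <= 1 by rewrite ltr01 lexx.
have half : 1 - 1 / 2 < (1 : R) by lra.
have [b0 /andP[_ b01] Pb0] := P_dense a01 half.
have /choice[b hb] : forall n, exists c, [/\ b0 < c, 1 - n.+1%:R^-1 < c & P c].
  move=> n; have n1 : Num.max b0 (1 - n.+1%:R^-1) < 1.
    by rewrite gt_max b01/= ltrBlDr ltrDl invr_gt0 ltr0n.
  have [c /andP[+ _] Pc] := P_dense a01 n1; rewrite gt_max => /andP[? ?].
  by exists c.
have /choice[x hx] : forall n, exists x, K (b n) x.
  by move=> n; have [_ _ /K_approx[[[x Kx] _] _]] := hb n; exists x.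
have cK : compact (K b0).
  by apply: compact_eucl; [have [[]] := K_approx Pb0|exact: K_closed].
have [|l _ hl] := compact_seq_cluster cK (x := x).
  by move=> n; have [bn _ _] := hb n; exact: K_subset (ltW bn) _ (hx n).
exists l; apply: le_anti; have /andP[_ ->] := is_fuzzy_limit l.
suff : level limit_fuzzy 1 l by [].
rewrite limit_level//= => c Pc c1; apply: closed_eucl => // e e0.
have c10 : 0 < 1 - c by rewrite subr_gt0.
have [N _ hN] := near_infty_natSinv_lt (PosNum c10).
have [k /hN/= kc lk] := hl e e0 N; exists (x k) => //.
have [_ bk _] := hb k; apply: K_subset (hx k); apply: ltW; apply: lt_trans bk.
by rewrite ltrBrDr addrC -ltrBrDr.
Qed.

Lemma compact_levels_limit : compact_levels limit_fuzzy.
Proof.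
split => //.
- apply: upper_semicontinuous_levels => // a a01; rewrite limit_level//.
  move=> x clx b Pb ba; apply: (K_closed (a := b)) => U /clx[z [Kz Uz]].
  by exists z; split => //; exact: Kz.
- move=> a a0; have m01 : 0 < Num.min a 1 <= 1.
    (* Capping at 1 provides a good height below [a] even when [a > 1]; its bounded set [K b]
       contains the level [a]. *)
    by rewrite lt_min a0 ltr01 ge_min lexx orbT.
  have m0 : 0 < Num.min a 1 by case/andP: m01.
  have [b /andP[_]] := P_dense m01 m0; rewrite lt_min => /andP[ba _] Pb.
  have [[_ [M KM]] _] := K_approx Pb; exists M => x /(limit_level_sub Pb ba).
  exact: KM.
Qed.

Lemma ae_level_dist_limit :
  {ae mu, forall a, level_dist (y k) limit_fuzzy a @[k --> \oo] --> 0}.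
Proof.
pose J := [set a | P a /\ exists2 x, ~ K a x & forall b, P b -> b < a -> K b x].
have cJ : countable J.
  by apply: countable_jumps => // a [a01 _] c ca; exact: P_dense.
have negJ : mu.-negligible J.
  exists J; split => //; last exact: countable_lebesgue_measure0.
  by apply: countable_measurable => // a; exact: measurable_set1.
have aeJ : {ae mu, forall a, ~ J a}.
  by apply: negligibleS negJ => a /= /contrapT.
apply: negligibleS (negligibleU aeP aeJ) => a /= ncvg.
apply: contrapT => /not_orP[/contrapT hC /contrapT nJa]; apply: ncvg.
have [a01|na01] := boolP (0 < a <= 1); last first.
  rewrite (_ : (fun k => _) = cst 0); first exact: cvg_cst.
  by apply/funext => k; rewrite /level_dist (negbTE na01).
have Pa : P a by [].
have [nK [C hK]] := K_approx Pa.
(* A point of the level outside [K a] would make [a] a jump, and jumps were excluded as a countable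
   set. *)
have levelE : level limit_fuzzy a = K a.
  apply/seteqP; split=> x => [ax|Kax]; last exact: le_limit_fuzzy.
  apply: contrapT => nKax; apply: nJa; split=> //; exists x => // b Pb ba.
  exact: limit_level_sub Pb ba _ ax.
have half : `|2^-1 : R| < 1 by rewrite ger0_norm ?invf_lt1// ltr1n.
apply: (@squeeze_cvgr _ _ _ _ (cst 0) (geometric C 2^-1)).
- apply: nearW => k; rewrite /= level_dist_ge0/=.
  by rewrite /level_dist a01 levelE; exact: hK.
- exact: cvg_cst.
- exact: cvg_geometric.
Qed.

End limit_fuzzy_set.

(** For [l > 0] differentiability of the power gives continuity; at [l = 0] the threshold is [e] to
    the power [p^-1]. *)
Lemma cvg_powR (R : realType) (p l : R) (f : nat -> R) : 0 < p ->
  (forall k, 0 <= f k) -> 0 <= l -> f k @[k --> \oo] --> l ->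
  f k `^ p @[k --> \oo] --> l `^ p.
Proof.
move=> p0 f0; rewrite le_eqVlt => /predU1P[<-|l0] fl; last first.
  have lin : l \in `]0, +oo[ by rewrite in_itv/= l0.
  have /derivable1_diffP/differentiable_continuous cp :=
    derivable_powR (v := 1) (x := p) lin.
  exact: (cvg_comp _ _ fl cp).
rewrite powR0 ?gt_eqF//; apply/cvgrPdist_le => e e0.
have ep : 0 < e `^ p^-1 by rewrite powR_gt0.
move/cvgrPdist_le : fl => /(_ _ ep); apply: filterS => k.
rewrite !sub0r !normrN !ger0_norm ?powR_ge0// => fe.
have -> : e = (e `^ p^-1) `^ p by rewrite -powRrM mulVf ?gt_eqF// powRr1// ltW.
by rewrite ge0_ler_powR ?nnegrE ?powR_ge0// ltW.
Qed.

(** * Completeness of [F_Bp] *)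

Section completeness.
Context {R : realType} {m : nat} {p : R}.
Hypothesis p1 : 1 <= p.
Local Notation mu := (@lebesgue_measure R).

Let p0 : 0 < p. Proof. exact: lt_le_trans p1. Qed.

(** Almost everywhere convergence of levels makes [level_dist v (y k)] converge to [level_dist v u];
    Fatou then passes an eventual bound to the limit. *)
Lemma pow_dist_fatou (v : 'rV[R]_m -> R) (y : nat -> 'rV[R]_m -> R)
    (u : 'rV[R]_m -> R) (c : \bar R) :
  compact_levels v -> (forall k, compact_levels (y k)) -> compact_levels u ->
  {ae mu, forall a, level_dist (y k) u a @[k --> \oo] --> 0} ->
  (\forall k \near \oo, pow_dist (p := p) v (y k) <= c)%E ->
  (pow_dist (p := p) v u <= c)%E.
Proof.
move=> cv cy cu yu bnd.
pose f k (a : R) := (level_dist v (y k) a `^ p)%:E.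
have mf k : measurable_fun [set: R] (f k).
  by apply/measurable_EFinP; exact: measurable_pow_dist.
have f0 k (a : R) : (0 <= f k a)%E by rewrite lee_fin powR_ge0.
have lim_le : (limn_einf (fun k => \int[mu]_a f k a) <= c)%E.
  rewrite limn_einf_lim; apply: lime_le; first exact: is_cvg_einfs.
  have [N _ hN] := bnd; apply: nearW => j.
  (* The infimum over indices from [j] on is at most the term at [maxn j N], to which the eventual
     bound applies. *)
  apply: le_trans (hN (maxn j N) (leq_maxr _ _)).
  by apply: ereal_inf_lbound; exists (maxn j N) => //=; exact: leq_maxl.
apply: le_trans lim_le.
apply: le_trans (fatou mu measurableT mf (fun k a _ => f0 k a)).
apply: ae_ge0_le_integral => //.
- by move=> a _; rewrite lee_fin powR_ge0.
- by apply/measurable_EFinP; exact: measurable_pow_dist.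
- move=> a _; rewrite limn_einf_lim; apply: lime_ge; first exact: is_cvg_einfs.
  by apply: nearW => j; apply: le_ereal_inf_tmp => _ [k _ <-]; exact: f0.
- under eq_fun => a do rewrite limn_einf_lim.
  apply: (emeasurable_fun_cvg (fun j (a : R) => einfs (f ^~ a) j)) => [j|a _].
    exact: measurable_fun_einfs.
  exact: is_cvg_einfs.
apply: negligibleS yu => a /= nle; apply: contra_not nle => yu _.
suff /cvg_limn_einf_sup[-> _] : f k a @[k --> \oo] --> (level_dist v u a `^ p)%:E.
  exact: lexx.
apply: cvg_EFin; first exact: nearW.
apply: cvg_powR => [//|k|//|]; [exact: level_dist_ge0|exact: level_dist_ge0|].
apply/cvgrPdist_le => e e0; move/cvgrPdist_le : yu => /(_ _ e0).
apply: filterS => k; rewrite sub0r normrN ger0_norm ?level_dist_ge0// => ye.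
have t1 := level_dist_triangle a cv (cy k) cu.
have t2 := level_dist_triangle a cv cu (cy k).
rewrite (level_distC u) in t2.
by rewrite ler_norml; apply/andP; split; lra.
Qed.

Lemma F_Bp_complete : complete_on (@F_Bp R m p) (d_p p).
Proof.
move=> x Fx cx; have cl n := F_Bp_compact_levels p1 (Fx n).
(* Rate [4^-1] in [d_p] leaves rate [2^-1] for the levels at almost every height. *)
have e4 k : 0 < (4^-1 : R) ^+ k by rewrite exprn_gt0.
have [n [kn fast]] := cauchy_fast_subsequence e4 cx.
pose y k := x (n k); have cy k : compact_levels (y k) by exact: cl.
have aeP : {ae mu, forall a, exists C, forall k,
    level_dist (y k) (y k.+1) a <= C * 2^-1 ^+ k}.
  apply: (ae_geometric_bound p1) => [k a|k|k].
  - exact: level_dist_ge0.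
  - exact: measurable_level_dist.
  - apply: (d_p_leP p1 (cy k) (cy k.+1) (ltW (e4 k))).1; exact: ltW (fast k).
pose u := limit_fuzzy y; have cu : compact_levels u by exact: compact_levels_limit.
have close e : 0 < e -> exists N, forall i, (N <= i)%N -> (d_p p (x i) u <= e%:E)%E.
  move=> e0; have [N hN] := cx e e0; exists N => i Ni.
  apply: (d_p_leP p1 (cl i) cu (ltW e0)).2.
  (* With [i] fixed, the Cauchy bound between [x i] and [y k] holds for [k >= N], since [n k >= k],
     and survives in the limit. *)
  apply: (pow_dist_fatou (cl i) cy cu (ae_level_dist_limit cy aeP)).
  exists N => // k /= Nk; apply: (d_p_leP p1 (cl i) (cy k) (ltW e0)).1.
  exact: ltW (hN i (n k) Ni (leq_trans Nk (kn k))).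
have co := @compact_levels_origin_indic R m.
exists u.
  apply: (F_BpP p1 u).2; split; first exact: cu.
  have [N /(_ N (leqnn N)) hN] := close 1 ltr01.
  (* The limit is at finite distance from [x N], which is at finite distance from [origin_indic]. *)
  apply: le_lt_trans (d_p_triangle p1 cu (cl N) co) _.
  rewrite d_pC; apply: lte_add_pinfty; first exact: le_lt_trans hN (ltry _).
  by have [] := (F_BpP p1 (x N)).1 (Fx N).
apply/fine_cvgP; split.
  have [N hN] := close 1 ltr01; exists N => // i /hN di.
  rewrite ge0_fin_numE; last exact: d_p_ge0.
  exact: le_lt_trans di (ltry _).
apply/cvgrPdist_le => e /close[N hN]; exists N => // i /= /hN di.
rewrite sub0r normrN ger0_norm; last by apply: fine_ge0; exact: d_p_ge0.
rewrite -lee_fin fineK; first exact: di.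
rewrite ge0_fin_numE; last exact: d_p_ge0.
exact: le_lt_trans di (ltry _).
Qed.

End completeness.

Theorem theorem5p3 (R : realType) (m : nat) (hm : (1 <= m)%N)
    (p : R) (hp : 1 <= p) :
  is_completion (@F_B R m) (@F_Bp R m p) (@d_p R m p).
Proof.
split.
- exact: metric_on_F_Bp.
- exact: F_B_sub_F_Bp.
- exact: F_Bp_complete.
- exact: F_B_dense.
Qed.
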